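(* Let $\mathcal{Q}$ be a small quantaloid and let $\mathfrak{T}=(\mathcal{T},\mathsf{m},\mathsf{e})$ be a 2-monad on $\mathcal{Q}\text{-}\mathbf{Cat}$ such that $\mathcal{T}$ preserves the full fidelity of all Yoneda functors, i.e. $\mathcal{T}\mathsf{y}_X$ is fully faithful for every $\mathcal{Q}$-category $X$. Then $\overline{\mathcal{T}}$ is a flat lax extension of the monad $\mathfrak{T}$ to $\mathcal{Q}\text{-}\mathbf{Dist}$, and it is the only flat lax extension of $\mathfrak T$ to $\mathcal{Q}\text{-}\mathbf{Dist}$.
   Context: A quantaloid $\mathcal{Q}$ is a category whose hom-sets are complete lattices such that composition preserves arbitrary suprema in each variable; $\mathcal{Q}_0=\mathrm{ob}\,\mathcal{Q}$. For $\alpha:p\to q,\beta:q\to r,\gamma:p\to r$: $\alpha\le\beta\searrow\gamma\iff\beta\circ\alpha\le\gamma\iff\beta\le\gamma\swarrow\alpha$; the same notation is used in $\mathcal{Q}\text{-}\mathbf{Dist}$ below. A $\mathcal{Q}$-relation $r:X\nrightarrow Y$ between sets over $\mathcal{Q}_0$ (sets with a type map $|\cdot|$ to $\mathcal{Q}_0$) is a family of morphisms $r(x,y):|x|\to|y|$ in $\mathcal{Q}$; $(s\circ r)(x,z)=\bigvee_y s(y,z)\circ r(x,y)$; the identity is $1_X^\circ$ with $1_X^\circ(x,x)=1_{|x|}$ and $1_X^\circ(x,y)=\bot$ for $x\ne y$; order pointwise. A $\mathcal{Q}$-category is $(X,a)$ with $a:X\nrightarrow X$, $1_X^\circ\le a$,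 $a\circ a\le a$. A $\mathcal{Q}$-functor $f:(X,a)\to(Y,b)$ is a type-preserving map with $a(x,x')\le b(fx,fx')$; it is fully faithful if equality always holds; $f\le g$ iff $1_{|x|}\le b(fx,gx)$ for all $x$. This gives the 2-category $\mathcal{Q}\text{-}\mathbf{Cat}$; a 2-functor on it is a functor monotone on homs; a 2-monad is a monad whose endofunctor is a 2-functor. A $\mathcal{Q}$-distributor $\varphi:(X,a)\nrightarrow(Y,b)$ is a $\mathcal{Q}$-relation with $b\circ\varphi\circ a\le\varphi$; these form the quantaloid $\mathcal{Q}\text{-}\mathbf{Dist}$ with composition and order as for $\mathcal{Q}$-relations and identity $1^*_{(X,a)}=a$. For a $\mathcal{Q}$-functor $f:(X,a)\to(Y,b)$: $f_*:X\nrightarrow Y$, $f_*(x,y)=b(fx,y)$, and $f^*:Y\nrightarrow X$, $f^*(y,x)=b(y,fx)$. $\mathcal{P}X$ is the $\mathcal{Q}$-category of distributors $\sigma:X\nrightarrow\{s\}$, $s\in\mathcal{Q}_0$ ($\{s\}$ is the one-object $\mathcal{Q}$-category of type $s$ with hom $1_s$), with $|\sigma|=s$ and hom $1^*_{\mathcal{P}X}(\sigma,\tau)=\tau\swarrow\sigma$. The Yoneda functor is $\mathsf{y}_X:X\to\mathcal{P}X$, $x\mapsto a(-,x)$. For a distributor $\varphi:X\nrightarrow Y$, $\overleftarrow{\varphi}:Y\to\mathcal{P}X$ is the $\mathcal{Q}$-functor $y\mapsto\varphi(-,y)$. A lax extension of the 2-functor $\mathcal{T}$ to $\mathcal{Q}\text{-}\mathbf{Dist}$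 is a lax 2-functor $\hat{\mathcal{T}}:\mathcal{Q}\text{-}\mathbf{Dist}\to\mathcal{Q}\text{-}\mathbf{Dist}$ (monotone on homs, $1^*_{\hat{\mathcal{T}}X}\le\hat{\mathcal{T}}1_X^*$, $\hat{\mathcal{T}}\psi\circ\hat{\mathcal{T}}\varphi\le\hat{\mathcal{T}}(\psi\circ\varphi)$) agreeing with $\mathcal{T}$ on objects with $(\mathcal{T}f)_*\le\hat{\mathcal{T}}(f_* )$ and $(\mathcal{T}f)^*\le\hat{\mathcal{T}}(f^* )$ for all $\mathcal{Q}$-functors $f$; it is flat if these two inequalities are always equalities. It is a lax extension of the monad $(\mathcal{T},\mathsf{m},\mathsf{e})$ if moreover $(\mathsf{m}_Y)_*\circ\hat{\mathcal{T}}\hat{\mathcal{T}}\varphi\le\hat{\mathcal{T}}\varphi\circ(\mathsf{m}_X)_*$ and $(\mathsf{e}_Y)_*\circ\varphi\le\hat{\mathcal{T}}\varphi\circ(\mathsf{e}_X)_*$ for all distributors $\varphi:X\nrightarrow Y$. Finally, $\overline{\mathcal{T}}X=\mathcal{T}X$ and $\overline{\mathcal{T}}\varphi:=(\mathcal{T}\overleftarrow{\varphi})^*\circ(\mathcal{T}\mathsf{y}_X)_*$ for every distributor $\varphi:X\nrightarrow Y$. *)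

(* Defs.v *)
From Stdlib Require Import Relations Setoid FunctionalExtensionality ProofIrrelevance.

Set Implicit Arguments.
Unset Strict Implicit.
Unset Printing Implicit Defensive.

Declare Scope qtld_scope.
Declare Scope qrel_scope.
Declare Scope dist_scope.
Declare Scope qfun_scope.
Delimit Scope qtld_scope with Q.
Delimit Scope qrel_scope with R.
Delimit Scope dist_scope with D.
Delimit Scope qfun_scope with F.

(* Suprema are taken over predicates on a hom-set, i.e. over its subsets.
   Smallness: the objects form a [Type], and the universe of the carriers of
   Q-categories below is at least as large as those of objects and homs. *)
Record Quantaloid := {
  ob : Type;
  hom : ob -> ob -> Type;
  qle : forall p q, hom p q -> hom p q -> Prop;
  qle_order : forall p q, order (hom p q) (@qle p q);
  sup : forall p q, (hom p q -> Prop) -> hom p q;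
  sup_ub : forall p q (S : hom p q -> Prop) h, S h -> qle h (sup S);
  sup_least : forall p q (S : hom p q -> Prop) u,
    (forall h, S h -> qle h u) -> qle (sup S) u;
  qid : forall p, hom p p;
  comp : forall p q r, hom q r -> hom p q -> hom p r;
  comp_assoc : forall p q r s (w : hom r s) (v : hom q r) (u : hom p q),
    comp w (comp v u) = comp (comp w v) u;
  comp_id_l : forall p q (u : hom p q), comp (qid q) u = u;
  comp_id_r : forall p q (u : hom p q), comp u (qid p) = u;
  comp_sup_l : forall p q r (S : hom q r -> Prop) (u : hom p q),
    comp (sup S) u = sup (fun h => exists v, S v /\ h = comp v u);
  comp_sup_r : forall p q r (v : hom q r) (S : hom p q -> Prop),
    comp v (sup S) = sup (fun h => exists u, S u /\ h = comp v u)
}.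

Arguments hom Q p q : clear implicits, rename.
Arguments qid {Q} p : rename.
Arguments qle_order Q p q : clear implicits, rename.

Infix "<=" := (@qle _ _ _) : qtld_scope.
Infix "∘" := (@comp _ _ _ _) (at level 40, left associativity) : qtld_scope.
Open Scope qtld_scope.

Section HomLemmas.
Variable Q : Quantaloid.

Lemma qle_refl p q (u : hom Q p q) : u <= u.
Proof. exact (ord_refl _ _ (qle_order Q p q) u). Qed.

Lemma qle_trans p q (u v w : hom Q p q) : u <= v -> v <= w -> u <= w.
Proof. exact (ord_trans _ _ (qle_order Q p q) u v w). Qed.

Lemma qle_antisym p q (u v : hom Q p q) : u <= v -> v <= u -> u = v.
Proof. exact (ord_antisym _ _ (qle_order Q p q) u v). Qed.

Lemma comp_sup_l_le p q r (S : hom Q q r -> Prop) (u : hom Q p q) w :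
  (forall v, S v -> v ∘ u <= w) -> sup S ∘ u <= w.
Proof.
intros H. rewrite comp_sup_l. apply sup_least.
intros h [v [Sv ->]]. exact (H v Sv).
Qed.

Lemma comp_sup_r_le p q r (v : hom Q q r) (S : hom Q p q -> Prop) w :
  (forall u, S u -> v ∘ u <= w) -> v ∘ sup S <= w.
Proof.
intros H. rewrite comp_sup_r. apply sup_least.
intros h [u [Su ->]]. exact (H u Su).
Qed.

Lemma sup_pair p q (u u' : hom Q p q) : u <= u' ->
  sup (fun h => h = u \/ h = u') = u'.
Proof.
intros H. apply qle_antisym.
- apply sup_least. intros h [-> | ->]; [exact H | apply qle_refl].
- apply sup_ub. now right.
Qed.

Lemma comp_mono p q r (v v' : hom Q q r) (u u' : hom Q p q) :
  v <= v' -> u <= u' -> v ∘ u <= v' ∘ u'.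
Proof.
intros Hv Hu. apply qle_trans with (v' ∘ u).
- rewrite <- (sup_pair Hv), comp_sup_l. apply sup_ub.
  exists v. split; [now left | reflexivity].
- rewrite <- (sup_pair Hu), comp_sup_r. apply sup_ub.
  exists u. split; [now left | reflexivity].
Qed.

End HomLemmas.

(* A set over [ob Q] is presented by the fibres of its type map: [X p] is the
   set of elements of type [p].  A type-preserving map X -> Y is then a family
   [forall p, X p -> Y p], and no transport along equations between types
   |fx| = |x| is needed. *)
Notation QSet Q := (ob Q -> Type).

Definition QRel (Q : Quantaloid) (X Y : QSet Q) :=
  forall p q, X p -> Y q -> hom Q p q.

Section Relations.
Variable Q : Quantaloid.

Definition rle (X Y : QSet Q) (r s : QRel X Y) : Prop :=
  forall p q (x : X p) (y : Y q), r p q x y <= s p q x y.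

Definition rcomp (X Y Z : QSet Q) (s : QRel Y Z) (r : QRel X Y) : QRel X Z :=
  fun p t x z =>
    sup (fun h => exists q (y : Y q), h = s q t y z ∘ r p q x y).

Inductive idset (X : QSet Q) (p : ob Q) (x : X p) :
  forall q, X q -> hom Q p q -> Prop := idset_id : idset x x (qid p).

(* [idset x y] is {1_p} when x and y are the same element of type p and empty
   otherwise, so the supremum is 1_p on the diagonal and bottom off it. *)
Definition rid (X : QSet Q) : QRel X X := fun p q x y => sup (idset x y).
Arguments rid X : clear implicits.

Lemma rcomp_le (X Y Z : QSet Q) (s : QRel Y Z) (r : QRel X Y) (t : QRel X Z) :
  rle (rcomp s r) t <->
  forall p q o (x : X p) (y : Y q) (z : Z o),
    s q o y z ∘ r p q x y <= t p o x z.
Proof.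
split.
- intros H p q o x y z. eapply qle_trans; [| exact (H p o x z)].
  apply sup_ub. now exists q, y.
- intros H p o x z. apply sup_least. intros h [q [y ->]]. apply H.
Qed.

Lemma rid_le (X : QSet Q) (a : QRel X X) :
  rle (rid X) a <-> forall p (x : X p), qid p <= a p p x x.
Proof.
split.
- intros H p x. eapply qle_trans; [| exact (H p p x x)].
  apply sup_ub. constructor.
- intros H p q x y. apply sup_least. intros h Hh. destruct Hh. apply H.
Qed.

End Relations.

Arguments rid {Q} X.
Infix "<=" := (@rle _ _ _) : qrel_scope.
Infix "∘" := (@rcomp _ _ _ _) (at level 40, left associativity) : qrel_scope.

Record QCat (Q : Quantaloid) := {
  carrier :> QSet Q;
  chom : forall p q, carrier p -> carrier q -> hom Q p q;
  chom_id : (rid carrier <= chom)%R;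
  chom_comp : (chom ∘ chom <= chom)%R
}.

Arguments chom {Q} X {p q} x y : rename.
Arguments chom_id {Q} X : rename.
Arguments chom_comp {Q} X : rename.

Record QFunctor (Q : Quantaloid) (X Y : QCat Q) := {
  fn :> forall p, X p -> Y p;
  fn_le : forall p q (x : X p) (x' : X q),
    chom X x x' <= chom Y (fn x) (fn x')
}.

Arguments fn {Q X Y} f {p} x : rename.
Arguments fn_le {Q X Y} f {p q} x x' : rename.

Section Functors.
Variable Q : Quantaloid.
Implicit Types X Y Z : QCat Q.

Lemma chom_refl X p (x : X p) : qid p <= chom X x x.
Proof. exact (proj1 (rid_le _) (chom_id X) p x). Qed.

Lemma chom_trans X p q r (x : X p) (y : X q) (z : X r) :
  chom X y z ∘ chom X x y <= chom X x z.
Proof. exact (proj1 (rcomp_le _ _ _) (chom_comp X) p q r x y z). Qed.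

Lemma qfunctor_eq X Y (f g : QFunctor X Y) :
  (forall p (x : X p), f p x = g p x) -> f = g.
Proof.
destruct f as [f Hf], g as [g Hg]; simpl; intros H.
assert (E : f = g).
{ apply functional_extensionality_dep; intros p.
  apply functional_extensionality_dep; intros x. apply H. }
subst g. f_equal. apply proof_irrelevance.
Qed.

Definition fid X : QFunctor X X :=
  {| fn := fun p x => x; fn_le := fun p q x x' => qle_refl _ |}.

Definition fcomp X Y Z (g : QFunctor Y Z) (f : QFunctor X Y) : QFunctor X Z :=
  {| fn := fun p x => fn g (fn f x);
     fn_le := fun p q x x' => qle_trans (fn_le f x x') (fn_le g _ _) |}.

Definition fully_faithful X Y (f : QFunctor X Y) : Prop :=
  forall p q (x : X p) (x' : X q), chom X x x' = chom Y (fn f x) (fn f x').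

Definition fle X Y (f g : QFunctor X Y) : Prop :=
  forall p (x : X p), qid p <= chom Y (fn f x) (fn g x).

End Functors.

Infix "<=" := (@fle _ _ _) : qfun_scope.
Infix "∘" := (@fcomp _ _ _ _) (at level 40, left associativity) : qfun_scope.

Record Dist (Q : Quantaloid) (X Y : QCat Q) := {
  drel :> forall p q, X p -> Y q -> hom Q p q;
  drel_dist : (@chom Q Y ∘ (drel ∘ @chom Q X) <= drel)%R
}.

Arguments drel {Q X Y} phi {p q} x y : rename.
Arguments drel_dist {Q X Y} phi : rename.

Section Distributors.
Variable Q : Quantaloid.
Implicit Types X Y Z : QCat Q.

Lemma is_distP X Y (r : QRel X Y) :
  (@chom Q Y ∘ (r ∘ @chom Q X) <= r)%R <->
  forall p p' q q' (x : X p) (x' : X p') (y : Y q) (y' : Y q'),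
    chom Y y y' ∘ (r p q x y ∘ chom X x' x) <= r p' q' x' y'.
Proof.
rewrite rcomp_le. split.
- intros H p p' q q' x x' y y'. eapply qle_trans; [| apply (H p' q q' x' y y')].
  apply comp_mono; [apply qle_refl |]. apply sup_ub. now exists p, x.
- intros H p q o x y z. apply comp_sup_r_le. intros u [p' [x' ->]]. apply H.
Qed.

Lemma dist_l X Y (phi : Dist X Y) p q q' (x : X p) (y : Y q) (y' : Y q') :
  chom Y y y' ∘ drel phi x y <= drel phi x y'.
Proof.
eapply qle_trans;
  [| exact (proj1 (is_distP _) (drel_dist phi) p p q q' x x y y')].
apply comp_mono; [apply qle_refl |].
rewrite <- (comp_id_r (drel phi x y)) at 1.
apply comp_mono; [apply qle_refl | apply chom_refl].
Qed.

Lemma dist_r X Y (phi : Dist X Y) p p' q (x : X p) (x' : X p') (y : Y q) :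
  drel phi x y ∘ chom X x' x <= drel phi x' y.
Proof.
eapply qle_trans;
  [| exact (proj1 (is_distP _) (drel_dist phi) p p' q q x x' y y)].
rewrite <- (comp_id_l (drel phi x y ∘ chom X x' x)) at 1.
apply comp_mono; [apply chom_refl | apply qle_refl].
Qed.

Lemma is_dist_intro X Y (r : QRel X Y) :
  (forall p q q' (x : X p) (y : Y q) (y' : Y q'),
     chom Y y y' ∘ r p q x y <= r p q' x y') ->
  (forall p p' q (x : X p) (x' : X p') (y : Y q),
     r p q x y ∘ chom X x' x <= r p' q x' y) ->
  (@chom Q Y ∘ (r ∘ @chom Q X) <= r)%R.
Proof.
intros Hl Hr. apply is_distP. intros p p' q q' x x' y y'.
eapply qle_trans; [| apply (Hl p' q q' x' y y')].
apply comp_mono; [apply qle_refl | apply Hr].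
Qed.

Lemma dist_eq X Y (phi psi : Dist X Y) :
  (forall p q (x : X p) (y : Y q), drel phi x y = drel psi x y) -> phi = psi.
Proof.
destruct phi as [r Hr], psi as [s Hs]; simpl; intros H.
assert (E : r = s).
{ apply functional_extensionality_dep; intros p.
  apply functional_extensionality_dep; intros q.
  apply functional_extensionality_dep; intros x.
  apply functional_extensionality_dep; intros y. apply H. }
subst s. f_equal. apply proof_irrelevance.
Qed.

Definition dle X Y (phi psi : Dist X Y) : Prop :=
  (@drel Q X Y phi <= @drel Q X Y psi)%R.

Program Definition dcomp X Y Z (psi : Dist Y Z) (phi : Dist X Y) : Dist X Z :=
  {| drel := (@drel Q Y Z psi ∘ @drel Q X Y phi)%R |}.
Next Obligation.
apply is_dist_intro.
- intros p q q' x z z'. apply comp_sup_r_le. intros u [o [y ->]].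
  rewrite comp_assoc. eapply qle_trans.
  + apply comp_mono; [apply dist_l | apply qle_refl].
  + apply sup_ub. now exists o, y.
- intros p p' q x x' z. apply comp_sup_l_le. intros u [o [y ->]].
  rewrite <- comp_assoc. eapply qle_trans.
  + apply comp_mono; [apply qle_refl | apply dist_r].
  + apply sup_ub. now exists o, y.
Qed.

Program Definition did X : Dist X X := {| drel := @chom Q X |}.
Next Obligation.
apply is_dist_intro; intros; apply chom_trans.
Qed.

Program Definition dsup X Y (S : Dist X Y -> Prop) : Dist X Y :=
  {| drel := fun p q x y =>
       sup (fun h => exists phi, S phi /\ h = drel phi x y) |}.
Next Obligation.
apply is_dist_intro.
- intros p q q' x y y'. apply comp_sup_r_le. intros u [phi [Sphi ->]].
  eapply qle_trans; [apply dist_l |]. apply sup_ub. now exists phi.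
- intros p p' q x x' y. apply comp_sup_l_le. intros u [phi [Sphi ->]].
  eapply qle_trans; [apply dist_r |]. apply sup_ub. now exists phi.
Qed.

(* The residual  psi ↙ phi, right adjoint to (- ∘ phi); see [dresP]. *)
Definition dres X Y Z (psi : Dist X Z) (phi : Dist X Y) : Dist Y Z :=
  dsup (fun chi => dle (dcomp chi phi) psi).

Lemma dresP X Y Z (psi : Dist X Z) (phi : Dist X Y) (chi : Dist Y Z) :
  dle (dcomp chi phi) psi <-> dle chi (dres psi phi).
Proof.
split.
- intros H p q x y. apply sup_ub. now exists chi.
- intros H. apply rcomp_le. intros p q o x y z.
  apply qle_trans with (drel (dres psi phi) y z ∘ drel phi x y).
  + apply comp_mono; [apply H | apply qle_refl].
  + apply comp_sup_l_le. intros u [chi' [H' ->]].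
    exact (proj1 (rcomp_le _ _ _) H' p q o x y z).
Qed.

(* f_* (x, y) = b (f x, y) *)
Program Definition dgraph X Y (f : QFunctor X Y) : Dist X Y :=
  {| drel := fun p q x y => chom Y (fn f x) y |}.
Next Obligation.
apply is_dist_intro.
- intros. apply chom_trans.
- intros p p' q x x' y. eapply qle_trans; [| apply (@chom_trans Q Y _ _ _ _ (fn f x))].
  apply comp_mono; [apply qle_refl | apply fn_le].
Qed.

(* f^* (y, x) = b (y, f x) *)
Program Definition dcograph X Y (f : QFunctor X Y) : Dist Y X :=
  {| drel := fun p q y x => chom Y y (fn f x) |}.
Next Obligation.
apply is_dist_intro.
- intros p q q' y x x'. eapply qle_trans; [| apply (@chom_trans Q Y _ _ _ _ (fn f x))].
  apply comp_mono; [apply fn_le | apply qle_refl].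
- intros. apply chom_trans.
Qed.

End Distributors.

Infix "<=" := (@dle _ _ _) : dist_scope.
Infix "∘" := (@dcomp _ _ _ _) (at level 40, left associativity) : dist_scope.
Infix "↙" := (@dres _ _ _ _) (at level 40, left associativity) : dist_scope.

(* The set {s} over [ob Q]: one element [pt], of type [s]. *)
Inductive point (Q : Quantaloid) (s : ob Q) : ob Q -> Type := pt : point s s.
Arguments pt {Q s}.

Section Presheaves.
Variable Q : Quantaloid.
Implicit Types X Y : QCat Q.

Program Definition star (s : ob Q) : QCat Q :=
  {| carrier := point s;
     chom := fun p q x y =>
       match x in point _ p', y in point _ q' return hom Q p' q' with
       | pt, pt => qid s
       end |}.
Next Obligation.
apply rid_le. intros p []. apply qle_refl.
Qed.
Next Obligation.
apply rcomp_le. intros p q o [] [] []. rewrite comp_id_l. apply qle_refl.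
Qed.

Program Definition Presheaf X : QCat Q :=
  {| carrier := fun s => Dist X (star s);
     chom := fun s t sigma tau => drel (tau ↙ sigma)%D pt pt |}.
Next Obligation.
apply rid_le. intros s sigma.
refine (proj1 (dresP sigma sigma (did (star s))) _ s s pt pt).
apply rcomp_le. intros p q o x y z. apply dist_l.
Qed.
Next Obligation.
apply rcomp_le. intros s t u sigma tau rho.
apply qle_trans with (drel ((rho ↙ tau) ∘ (tau ↙ sigma))%D pt pt).
{ apply sup_ub. now exists t, pt. }
refine (proj1 (dresP rho sigma ((rho ↙ tau) ∘ (tau ↙ sigma))%D) _ s u pt pt).
apply rcomp_le. intros p q o x y z.
apply comp_sup_l_le. intros h [r [w ->]]. rewrite <- comp_assoc.
eapply qle_trans.
- apply comp_mono; [apply qle_refl |].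
  exact (proj1 (rcomp_le _ _ _)
          (proj2 (dresP tau sigma _) (fun _ _ _ _ => qle_refl _)) p q r x y w).
- exact (proj1 (rcomp_le _ _ _)
          (proj2 (dresP rho tau _) (fun _ _ _ _ => qle_refl _)) p r o x w z).
Qed.

(* The distributor phi(-, y) : X -|-> {q} for y of type q. *)
Program Definition column X Y (phi : Dist X Y) (q : ob Q) (y : Y q) :
    Dist X (star q) :=
  {| drel := fun p r x z =>
       match z in point _ r' return hom Q p r' with
       | pt => drel phi x y
       end |}.
Next Obligation.
apply (@is_dist_intro Q X (star q)).
- intros p r r' x z z'. destruct z, z'. simpl.
  rewrite comp_id_l. apply qle_refl.
- intros p p' r x x' z. destruct z. apply dist_r.
Qed.

(* A morphism u : s -> t of Q, seen as a distributor {s} -|-> {t}. *)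
Program Definition dpoint (s t : ob Q) (u : hom Q s t) :
    Dist (star s) (star t) :=
  {| drel := fun p q x y =>
       match x in point _ p', y in point _ q' return hom Q p' q' with
       | pt, pt => u
       end |}.
Next Obligation.
apply (@is_dist_intro Q (star s) (star t)).
- intros p q q' [] [] []. simpl. rewrite comp_id_l. apply qle_refl.
- intros p p' q [] [] []. simpl. rewrite comp_id_r. apply qle_refl.
Qed.

Lemma presheaf_homP X (s t : ob Q) (sigma : Presheaf X s) (tau : Presheaf X t)
    (u : hom Q s t) :
  u <= chom (Presheaf X) sigma tau <->
  forall p (x : X p), u ∘ drel sigma x pt <= drel tau x pt.
Proof.
split.
- intros H p x. eapply qle_trans.
  + apply comp_mono; [exact H | apply qle_refl].
  + exact (proj1 (rcomp_le _ _ _)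
      (proj2 (dresP tau sigma _) (fun _ _ _ _ => qle_refl _)) p s t x pt pt).
- intros H. refine (proj1 (dresP tau sigma (dpoint u)) _ s t pt pt).
  apply rcomp_le. intros p q o x [] []. apply H.
Qed.

(* The Q-functor usually written phi with a left arrow above it. *)
Program Definition transpose X Y (phi : Dist X Y) : QFunctor Y (Presheaf X) :=
  {| fn := fun q y => column phi y |}.
Next Obligation.
apply presheaf_homP. intros r z. exact (dist_l phi z x x').
Qed.

Definition yoneda X : QFunctor X (Presheaf X) := transpose (did X).

Lemma yonedaE X p q (x' : X p) (x : X q) :
  drel (fn (yoneda X) x) x' pt = chom X x' x.
Proof. reflexivity. Qed.

End Presheaves.

Record TwoFunctor (Q : Quantaloid) := {
  tob :> QCat Q -> QCat Q;
  tmap : forall X Y, QFunctor X Y -> QFunctor (tob X) (tob Y);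
  tmap_id : forall X, tmap (fid X) = fid (tob X);
  tmap_comp : forall X Y Z (g : QFunctor Y Z) (f : QFunctor X Y),
    tmap (g ∘ f)%F = (tmap g ∘ tmap f)%F;
  tmap_mono : forall X Y (f g : QFunctor X Y),
    (f <= g)%F -> (tmap f <= tmap g)%F
}.

Arguments tmap {Q} T {X Y} f : rename.

Record TwoMonad (Q : Quantaloid) := {
  mfun :> TwoFunctor Q;
  mult : forall X, QFunctor (mfun (mfun X)) (mfun X);
  unit : forall X, QFunctor X (mfun X);
  mult_nat : forall X Y (f : QFunctor X Y),
    (mult Y ∘ tmap mfun (tmap mfun f) = tmap mfun f ∘ mult X)%F;
  unit_nat : forall X Y (f : QFunctor X Y),
    (unit Y ∘ f = tmap mfun f ∘ unit X)%F;
  mult_assoc : forall X,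
    (mult X ∘ tmap mfun (mult X) = mult X ∘ mult (mfun X))%F;
  mult_unit_l : forall X, (mult X ∘ unit (mfun X) = fid (mfun X))%F;
  mult_unit_r : forall X, (mult X ∘ tmap mfun (unit X) = fid (mfun X))%F
}.

Arguments mult {Q} T X : rename.
Arguments unit {Q} T X : rename.

(* The action on distributors of an assignment Q-Dist -> Q-Dist which agrees
   with T on objects. *)
Definition DistMap (Q : Quantaloid) (T : TwoFunctor Q) :=
  forall X Y : QCat Q, Dist X Y -> Dist (T X) (T Y).

Section LaxExtensions.
Variable Q : Quantaloid.

Record is_lax_extension (T : TwoFunctor Q) (E : DistMap T) : Prop := {
  lax_mono : forall X Y (phi psi : Dist X Y),
    (phi <= psi -> E X Y phi <= E X Y psi)%D;
  lax_id : forall X, (did (T X) <= E X X (did X))%D;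
  lax_comp : forall X Y Z (psi : Dist Y Z) (phi : Dist X Y),
    (E Y Z psi ∘ E X Y phi <= E X Z (psi ∘ phi))%D;
  lax_graph : forall X Y (f : QFunctor X Y),
    (dgraph (tmap T f) <= E X Y (dgraph f))%D;
  lax_cograph : forall X Y (f : QFunctor X Y),
    (dcograph (tmap T f) <= E Y X (dcograph f))%D
}.

Definition is_flat (T : TwoFunctor Q) (E : DistMap T) : Prop :=
  forall X Y (f : QFunctor X Y),
    dgraph (tmap T f) = E X Y (dgraph f) /\
    dcograph (tmap T f) = E Y X (dcograph f).

Record is_lax_monad_extension (T : TwoMonad Q) (E : DistMap T) : Prop := {
  lax_functor : is_lax_extension E;
  lax_mult : forall X Y (phi : Dist X Y),
    (dgraph (mult T Y) ∘ E _ _ (E X Y phi) <= E X Y phi ∘ dgraph (mult T X))%D;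
  lax_unit : forall X Y (phi : Dist X Y),
    (dgraph (unit T Y) ∘ phi <= E X Y phi ∘ dgraph (unit T X))%D
}.

Definition is_flat_lax_monad_extension (T : TwoMonad Q) (E : DistMap T) : Prop :=
  is_lax_monad_extension E /\ is_flat E.

Definition Tbar (T : TwoFunctor Q) : DistMap T := fun X Y phi =>
  (dcograph (tmap T (transpose phi)) ∘ dgraph (tmap T (yoneda X)))%D.

End LaxExtensions.

(* Main.v *)
Require Import Defs.

(** Everything follows from the adjunctions [f_* ⊣ f^*] in Q-Dist and the Yoneda
    decomposition [phi = (transpose phi)^* ∘ y_*].  A flat lax extension
    commutes with postcomposition by [f^*] and with precomposition by [f_*], so
    it sends [phi] to [(T (transpose phi))^* ∘ (T y)_* = Tbar phi]; this gives
    uniqueness and computes [Tbar (Tbar phi)], after which the monad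
    inequalities reduce to naturality.  Lax functoriality and flatness of
    [Tbar] come from precomposition with [phi], a Q-functor PY -> PX which
    extends [transpose phi] along Yoneda; full faithfulness of [T y] is only
    needed for the two upper bounds in flatness. *)

Set Implicit Arguments.
Unset Strict Implicit.

Local Open Scope dist_scope.

(** * Order and composition in Q-Dist *)

Section DistAlgebra.
Variable Q : Quantaloid.
Implicit Types X Y Z W : QCat Q.

Lemma dle_refl X Y (phi : Dist X Y) : phi <= phi.
Proof. intros p q x y. apply qle_refl. Qed.

Lemma dle_trans X Y (phi psi chi : Dist X Y) :
  phi <= psi -> psi <= chi -> phi <= chi.
Proof. intros H K p q x y. exact (qle_trans (H p q x y) (K p q x y)). Qed.

Lemma dle_antisym X Y (phi psi : Dist X Y) :
  phi <= psi -> psi <= phi -> phi = psi.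
Proof.
intros H K. apply dist_eq. intros p q x y.
exact (qle_antisym (H p q x y) (K p q x y)).
Qed.

Lemma dcomp_le X Y Z (psi : Dist Y Z) (phi : Dist X Y) (chi : Dist X Z) :
  psi ∘ phi <= chi <->
  forall p q o (x : X p) (y : Y q) (z : Z o),
    (drel psi y z ∘ drel phi x y <= drel chi x z)%Q.
Proof. exact (rcomp_le _ _ _). Qed.

Lemma dcomp_ub X Y Z (psi : Dist Y Z) (phi : Dist X Y)
    p q o (x : X p) (y : Y q) (z : Z o) :
  (drel psi y z ∘ drel phi x y <= drel (psi ∘ phi)%D x z)%Q.
Proof. exact (proj1 (dcomp_le psi phi _) (dle_refl _) p q o x y z). Qed.

Lemma dcomp_mono X Y Z (psi psi' : Dist Y Z) (phi phi' : Dist X Y) :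
  psi <= psi' -> phi <= phi' -> psi ∘ phi <= psi' ∘ phi'.
Proof.
intros H K. apply dcomp_le. intros p q o x y z.
eapply qle_trans; [| apply (dcomp_ub psi' phi' x y z)].
apply comp_mono; [apply H | apply K].
Qed.

Lemma dcomp_mono_l X Y Z (psi psi' : Dist Y Z) (phi : Dist X Y) :
  psi <= psi' -> psi ∘ phi <= psi' ∘ phi.
Proof. intros H. apply dcomp_mono; [exact H | apply dle_refl]. Qed.

Lemma dcomp_mono_r X Y Z (psi : Dist Y Z) (phi phi' : Dist X Y) :
  phi <= phi' -> psi ∘ phi <= psi ∘ phi'.
Proof. intros H. apply dcomp_mono; [apply dle_refl | exact H]. Qed.

Lemma dcomp_assoc X Y Z W (chi : Dist Z W) (psi : Dist Y Z) (phi : Dist X Y) :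
  chi ∘ (psi ∘ phi) = chi ∘ psi ∘ phi.
Proof.
apply dle_antisym; apply dcomp_le; intros p q o x y z.
- apply comp_sup_r_le. intros u [r [w ->]]. rewrite comp_assoc.
  eapply qle_trans; [| apply (dcomp_ub (chi ∘ psi) phi x w z)].
  apply comp_mono; [apply dcomp_ub | apply qle_refl].
- apply comp_sup_l_le. intros u [r [w ->]]. rewrite <- comp_assoc.
  eapply qle_trans; [| apply (dcomp_ub chi (psi ∘ phi) x w z)].
  apply comp_mono; [apply qle_refl | apply dcomp_ub].
Qed.

Lemma dcomp_did_l X Y (phi : Dist X Y) : did Y ∘ phi = phi.
Proof.
apply dle_antisym.
- apply dcomp_le. intros. apply dist_l.
- intros p q x y. eapply qle_trans; [| apply (dcomp_ub (did Y) phi x y y)].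
  rewrite <- (comp_id_l (drel phi x y)) at 1.
  apply comp_mono; [apply chom_refl | apply qle_refl].
Qed.

Lemma dcomp_did_r X Y (phi : Dist X Y) : phi ∘ did X = phi.
Proof.
apply dle_antisym.
- apply dcomp_le. intros. apply dist_r.
- intros p q x y. eapply qle_trans; [| apply (dcomp_ub phi (did X) x x y)].
  rewrite <- (comp_id_r (drel phi x y)) at 1.
  apply comp_mono; [apply qle_refl | apply chom_refl].
Qed.

(** * Graphs, cographs and their adjunction *)

(** The supremum over the elements of [Z] is attained at [fn f x], where reflexivity supplies an
    identity. *)
Lemma dcograph_dgraphE X Y Z (f : QFunctor X Z) (g : QFunctor Y Z)
    p q (x : X p) (y : Y q) :
  drel (dcograph g ∘ dgraph f) x y = chom Z (fn f x) (fn g y).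
Proof.
apply qle_antisym.
- apply sup_least. intros h [r [z ->]]. apply chom_trans.
- eapply qle_trans;
    [| apply (dcomp_ub (dcograph g) (dgraph f) x (fn f x) y)]. simpl.
  rewrite <- (comp_id_r (chom Z (fn f x) (fn g y))) at 1.
  apply comp_mono; [apply qle_refl | apply chom_refl].
Qed.

Lemma dgraph_unit X Y (f : QFunctor X Y) : did X <= dcograph f ∘ dgraph f.
Proof. intros p q x y. rewrite dcograph_dgraphE. apply fn_le. Qed.

Lemma dgraph_counit X Y (f : QFunctor X Y) : dgraph f ∘ dcograph f <= did Y.
Proof. apply dcomp_le. intros. apply chom_trans. Qed.

Lemma dgraph_unit_ff X Y (f : QFunctor X Y) :
  fully_faithful f -> dcograph f ∘ dgraph f = did X.
Proof.
intros H. apply dist_eq. intros p q x y. rewrite dcograph_dgraphE.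
symmetry. apply H.
Qed.

Lemma dgraph_comp X Y Z (g : QFunctor Y Z) (f : QFunctor X Y) :
  dgraph (g ∘ f)%F = dgraph g ∘ dgraph f.
Proof.
apply dist_eq. intros p q x z. apply qle_antisym.
- eapply qle_trans; [| apply (dcomp_ub (dgraph g) (dgraph f) x (fn f x) z)].
  simpl. rewrite <- (comp_id_r (chom Z _ z)) at 1.
  apply comp_mono; [apply qle_refl | apply chom_refl].
- apply sup_least. intros h [r [y ->]]. simpl.
  eapply qle_trans; [| apply (chom_trans _ (fn g y))].
  apply comp_mono; [apply qle_refl | apply fn_le].
Qed.

Lemma dcograph_comp X Y Z (g : QFunctor Y Z) (f : QFunctor X Y) :
  dcograph (g ∘ f)%F = dcograph f ∘ dcograph g.
Proof.
apply dist_eq. intros p q z x. apply qle_antisym.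
- eapply qle_trans;
    [| apply (dcomp_ub (dcograph f) (dcograph g) z (fn f x) x)].
  simpl. rewrite <- (comp_id_l (chom Z z _)) at 1.
  apply comp_mono; [apply chom_refl | apply qle_refl].
- apply sup_least. intros h [r [y ->]]. simpl.
  eapply qle_trans; [| apply (chom_trans _ (fn g y))].
  apply comp_mono; [apply fn_le | apply qle_refl].
Qed.

Lemma dgraph_anti X Y (f g : QFunctor X Y) :
  (f <= g)%F -> dgraph g <= dgraph f.
Proof.
intros H p q x y. simpl. eapply qle_trans; [| apply (chom_trans _ (fn g x))].
rewrite <- (comp_id_r (chom Y _ y)) at 1.
apply comp_mono; [apply qle_refl | apply H].
Qed.

Lemma dcograph_mono X Y (f g : QFunctor X Y) :
  (f <= g)%F -> dcograph f <= dcograph g.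
Proof.
intros H p q y x. simpl. eapply qle_trans; [| apply (chom_trans _ (fn f x))].
rewrite <- (comp_id_l (chom Y y _)) at 1.
apply comp_mono; [apply H | apply qle_refl].
Qed.

(** The lax Beck-Chevalley inequality of a commuting square: insert the unit of [k], exchange
    [k ∘ h] for [g ∘ f], and cancel with the counit of [f]. *)
Lemma dgraph_dcograph_le X Y Z W (f : QFunctor X Y) (g : QFunctor Y W)
    (h : QFunctor X Z) (k : QFunctor Z W) :
  (g ∘ f = k ∘ h)%F -> dgraph h ∘ dcograph f <= dcograph k ∘ dgraph g.
Proof.
intros E.
apply dle_trans with (dcograph k ∘ dgraph k ∘ (dgraph h ∘ dcograph f)).
{ rewrite <- (dcomp_did_l (dgraph h ∘ dcograph f)) at 1.
  apply dcomp_mono_l, dgraph_unit. }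
rewrite <- dcomp_assoc. apply dcomp_mono_r.
rewrite dcomp_assoc, <- dgraph_comp, <- E, dgraph_comp, <- dcomp_assoc.
rewrite <- (dcomp_did_r (dgraph g)) at 2. apply dcomp_mono_r, dgraph_counit.
Qed.

(** * Yoneda, transposes and precomposition *)

(** By [dcograph_dgraphE] this is the Yoneda lemma for the presheaf [column phi y]: a bound on the
    hom out of [yoneda X] at [x] comes from evaluating at [x] itself. *)
Lemma yoneda_decomposition X Y (phi : Dist X Y) :
  dcograph (transpose phi) ∘ dgraph (yoneda X) = phi.
Proof.
apply dist_eq. intros p q x y. rewrite dcograph_dgraphE.
apply qle_antisym.
- rewrite <- (comp_id_r (chom (Presheaf X) _ _)).
  eapply qle_trans.
  + apply comp_mono; [apply qle_refl | apply (chom_refl x)].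
  + exact (proj1 (presheaf_homP _ _ _) (qle_refl _) p x).
- apply presheaf_homP. intros r z. exact (dist_r phi x z y).
Qed.

Lemma transpose_mono X Y (phi psi : Dist X Y) :
  phi <= psi -> (transpose phi <= transpose psi)%F.
Proof.
intros H q y. apply presheaf_homP. intros p x. rewrite comp_id_l. apply H.
Qed.

Program Definition precomp X Y (phi : Dist X Y) :
    QFunctor (Presheaf Y) (Presheaf X) :=
  {| fn := fun s sigma => sigma ∘ phi |}.
Next Obligation.
apply presheaf_homP. intros r z. apply comp_sup_r_le. intros u [o [y ->]].
rewrite comp_assoc.
eapply qle_trans; [| apply (dcomp_ub x' phi z y pt)].
apply comp_mono; [| apply qle_refl].
exact (proj1 (presheaf_homP _ _ _) (qle_refl _) o y).
Qed.

Lemma precomp_transpose X Y Z (psi : Dist Y Z) (phi : Dist X Y) :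
  (precomp phi ∘ transpose psi)%F = transpose (psi ∘ phi).
Proof.
apply qfunctor_eq. intros q z. apply dist_eq. intros p r x w.
destruct w. reflexivity.
Qed.

Lemma precomp_yoneda X Y (phi : Dist X Y) :
  (precomp phi ∘ yoneda Y)%F = transpose phi.
Proof. unfold yoneda. rewrite precomp_transpose, dcomp_did_l. reflexivity. Qed.

Lemma transpose_dcograph X Y (f : QFunctor X Y) :
  transpose (dcograph f) = (yoneda Y ∘ f)%F.
Proof.
apply qfunctor_eq. intros q z. apply dist_eq. intros p r x w.
destruct w. reflexivity.
Qed.

End DistAlgebra.

(** * Flat lax extensions and their uniqueness *)

Section FlatLaxExtension.
Variable Q : Quantaloid.
Variables (T : TwoFunctor Q) (E : DistMap T).
Hypothesis E_lax : is_lax_extension E.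
Hypothesis E_flat : is_flat E.
Implicit Types X Y Z : QCat Q.

(** For the nontrivial direction, the unit of [tmap T f] creates a cograph, which flatness and
    [lax_comp] absorb into [E]; there the counit of [f] cancels it. The next lemma is the dual
    argument. *)
Lemma flat_comp_dgraph X Y Z (psi : Dist Y Z) (f : QFunctor X Y) :
  E (psi ∘ dgraph f) = E psi ∘ dgraph (tmap T f).
Proof.
apply dle_antisym.
- apply dle_trans
    with (E (psi ∘ dgraph f) ∘ (dcograph (tmap T f) ∘ dgraph (tmap T f))).
  { rewrite <- (dcomp_did_r (E (psi ∘ dgraph f))) at 1.
    apply dcomp_mono_r, dgraph_unit. }
  rewrite dcomp_assoc. apply dcomp_mono_l.
  rewrite (proj2 (E_flat f)).
  eapply dle_trans; [apply (lax_comp E_lax) |]. apply (lax_mono E_lax).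
  rewrite <- dcomp_assoc. rewrite <- (dcomp_did_r psi) at 2.
  apply dcomp_mono_r, dgraph_counit.
- rewrite (proj1 (E_flat f)). apply (lax_comp E_lax).
Qed.

Lemma flat_dcograph_comp X Y Z (f : QFunctor Z Y) (phi : Dist X Y) :
  E (dcograph f ∘ phi) = dcograph (tmap T f) ∘ E phi.
Proof.
apply dle_antisym.
- apply dle_trans
    with (dcograph (tmap T f) ∘ dgraph (tmap T f) ∘ E (dcograph f ∘ phi)).
  { rewrite <- (dcomp_did_l (E (dcograph f ∘ phi))) at 1.
    apply dcomp_mono_l, dgraph_unit. }
  rewrite <- dcomp_assoc. apply dcomp_mono_r.
  rewrite (proj1 (E_flat f)).
  eapply dle_trans; [apply (lax_comp E_lax) |]. apply (lax_mono E_lax).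
  rewrite dcomp_assoc. rewrite <- (dcomp_did_l phi) at 2.
  apply dcomp_mono_l, dgraph_counit.
- rewrite (proj2 (E_flat f)). apply (lax_comp E_lax).
Qed.

Lemma flat_lax_extension_unique X Y (phi : Dist X Y) : E phi = Tbar T phi.
Proof.
rewrite <- (yoneda_decomposition phi) at 1.
rewrite flat_dcograph_comp, <- (proj1 (E_flat (yoneda X))). reflexivity.
Qed.

End FlatLaxExtension.

(** * [Tbar] as a flat lax extension of the functor *)

Section Tbar.
Variable Q : Quantaloid.
Implicit Types X Y Z : QCat Q.

Section TwoFunctor.
Variable T : TwoFunctor Q.

Lemma Tbar_mono X Y (phi psi : Dist X Y) :
  phi <= psi -> Tbar T phi <= Tbar T psi.
Proof.
intros H. apply dcomp_mono_l, dcograph_mono, tmap_mono, transpose_mono, H.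
Qed.

(** [yoneda X] is by definition the transpose of [did X], so the right side is the cograph of
    [tmap T (yoneda X)] after its graph. *)
Lemma Tbar_id X : did (T X) <= Tbar T (did X).
Proof. apply dgraph_unit. Qed.

(** Both [transpose (psi ∘ phi)] and [transpose phi] factor through [precomp phi]. What separates
    the two sides is then the graph of [tmap T (yoneda Y)] after its cograph, removed by the
    counit. *)
Lemma Tbar_comp X Y Z (psi : Dist Y Z) (phi : Dist X Y) :
  Tbar T psi ∘ Tbar T phi <= Tbar T (psi ∘ phi).
Proof.
unfold Tbar. rewrite <- (precomp_transpose psi phi), <- (precomp_yoneda phi).
rewrite !tmap_comp, !dcograph_comp, !dcomp_assoc. apply dcomp_mono_l.
apply dcomp_mono_l. rewrite <- dcomp_assoc.
rewrite <- (dcomp_did_r (dcograph (tmap T (transpose psi)))) at 2.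
apply dcomp_mono_r, dgraph_counit.
Qed.

Lemma Tbar_dgraph_ge X Y (f : QFunctor X Y) :
  dgraph (tmap T f) <= Tbar T (dgraph f).
Proof.
(* Pointwise this is functoriality of [f]. Since graphs reverse the order, its image under [T]
   bounds a composite of graphs by the graph of [tmap T (yoneda X)]. *)
assert (H : (yoneda X <= transpose (dgraph f) ∘ f)%F).
{ intros q x. apply presheaf_homP. intros p x'. rewrite comp_id_l.
  apply fn_le. }
apply (@tmap_mono _ T), dgraph_anti in H.
rewrite tmap_comp, dgraph_comp in H.
eapply dle_trans; [| apply dcomp_mono_r, H]. rewrite dcomp_assoc.
rewrite <- (dcomp_did_l (dgraph (tmap T f))) at 1.
apply dcomp_mono_l, dgraph_unit.
Qed.

Hypothesis T_yoneda : forall X, fully_faithful (tmap T (yoneda X)).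

Lemma Tbar_dcograph X Y (f : QFunctor X Y) :
  Tbar T (dcograph f) = dcograph (tmap T f).
Proof.
unfold Tbar. rewrite transpose_dcograph, tmap_comp, dcograph_comp.
rewrite <- dcomp_assoc, dgraph_unit_ff by apply T_yoneda.
apply dcomp_did_r.
Qed.

(* Uses the left adjoint [precomp f^*] of [precomp f_*]: it satisfies
   [precomp f^* ∘ y = y ∘ f] and sends [transpose f_*] below [y]. *)
Lemma Tbar_dgraph X Y (f : QFunctor X Y) :
  Tbar T (dgraph f) = dgraph (tmap T f).
Proof.
apply dle_antisym; [| apply Tbar_dgraph_ge].
set (g := precomp (dcograph f)).
assert (Hy : (g ∘ yoneda X = yoneda Y ∘ f)%F).
{ unfold g. rewrite precomp_yoneda. apply transpose_dcograph. }
assert (Hf : (g ∘ transpose (dgraph f) <= yoneda Y)%F).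
{ unfold g. rewrite precomp_transpose. apply transpose_mono, dgraph_counit. }
unfold Tbar.
(* The inserted unit of [tmap T g] splits: its graph meets [yoneda X], where [Hy] applies, and its
   cograph meets the transpose, where [Hf] applies. *)
apply dle_trans with (dcograph (tmap T (transpose (dgraph f))) ∘
  (dcograph (tmap T g) ∘ dgraph (tmap T g) ∘ dgraph (tmap T (yoneda X)))).
{ apply dcomp_mono_r.
  rewrite <- (dcomp_did_l (dgraph (tmap T (yoneda X)))) at 1.
  apply dcomp_mono_l, dgraph_unit. }
rewrite <- dcomp_assoc, <- dgraph_comp, <- tmap_comp, Hy.
rewrite dcomp_assoc, <- dcograph_comp, <- tmap_comp.
eapply dle_trans; [apply dcomp_mono_l, dcograph_mono, tmap_mono, Hf |].
rewrite tmap_comp, dgraph_comp, dcomp_assoc.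
rewrite dgraph_unit_ff by apply T_yoneda. rewrite dcomp_did_l. apply dle_refl.
Qed.

Lemma Tbar_flat : is_flat (Tbar T).
Proof.
intros X Y f. split; symmetry; [apply Tbar_dgraph | apply Tbar_dcograph].
Qed.

Lemma Tbar_lax_extension : is_lax_extension (Tbar T).
Proof.
split.
- apply Tbar_mono.
- apply Tbar_id.
- apply Tbar_comp.
- apply Tbar_dgraph_ge.
- intros X Y f. rewrite Tbar_dcograph. apply dle_refl.
Qed.

Lemma Tbar_Tbar X Y (phi : Dist X Y) :
  Tbar T (Tbar T phi) =
  dcograph (tmap T (tmap T (transpose phi))) ∘
    dgraph (tmap T (tmap T (yoneda X))).
Proof.
unfold Tbar at 2.
rewrite (flat_dcograph_comp Tbar_lax_extension Tbar_flat), Tbar_dgraph.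
reflexivity.
Qed.

End TwoFunctor.

(** * The monad inequalities *)

Variable T : TwoMonad Q.

(** Naturality at [yoneda X] makes its graph a common right factor; what remains is the lax square
    given by naturality at [transpose phi]. [Tbar_mult] follows the same pattern. *)
Lemma Tbar_unit X Y (phi : Dist X Y) :
  dgraph (unit T Y) ∘ phi <= Tbar T phi ∘ dgraph (unit T X).
Proof.
rewrite <- (yoneda_decomposition phi) at 1. unfold Tbar.
rewrite <- dcomp_assoc, <- dgraph_comp, <- unit_nat, dgraph_comp.
rewrite !dcomp_assoc. apply dcomp_mono_l, dgraph_dcograph_le, unit_nat.
Qed.

Lemma Tbar_mult (T_yoneda : forall X, fully_faithful (tmap T (yoneda X)))
    X Y (phi : Dist X Y) :
  dgraph (mult T Y) ∘ Tbar T (Tbar T phi) <= Tbar T phi ∘ dgraph (mult T X).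
Proof.
rewrite (Tbar_Tbar T_yoneda). unfold Tbar.
rewrite <- (dcomp_assoc _ _ (dgraph (mult T X))).
rewrite <- dgraph_comp, <- mult_nat, dgraph_comp.
rewrite !dcomp_assoc. apply dcomp_mono_l, dgraph_dcograph_le, mult_nat.
Qed.

End Tbar.

Theorem theorem4p4 (Q : Quantaloid) (T : TwoMonad Q)
  (T_yoneda : forall X : QCat Q, fully_faithful (tmap T (yoneda X))) :
  is_flat_lax_monad_extension (Tbar T) /\
  (forall E : DistMap T, is_flat_lax_monad_extension E ->
     forall (X Y : QCat Q) (phi : Dist X Y), E X Y phi = Tbar T phi).
Proof.
split.
- split; [| exact (Tbar_flat T_yoneda)]. split.
  + exact (Tbar_lax_extension T_yoneda).
  + exact (Tbar_mult T_yoneda).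
  + intros X Y phi. apply Tbar_unit.
- intros E [[E_lax _ _] E_flat] X Y phi.
  exact (flat_lax_extension_unique E_lax E_flat phi).
Qed.
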